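(* Let $n\ge 4$ be an integer and let $G$ be an $(n-3)$-regular graph of order $n$. Then the bondage number of $G$ is $b(G)=n-3$.
   Context: Graphs $G=(V,E)$ are finite, undirected, without loops or multiple edges; the order of $G$ is $|V(G)|$. A subset $D\subseteq V(G)$ is a dominating set of $G$ if every vertex not in $D$ is adjacent to some vertex of $D$. The domination number $\gamma(G)$ is the minimum cardinality of a dominating set of $G$. For $B\subseteq E(G)$, $G-B$ denotes the graph with vertex set $V(G)$ and edge set $E(G)\setminus B$. For a graph $G$ with at least one edge, the bondage number is $b(G)=\min\{|B| : B\subseteq E(G),\ \gamma(G-B)>\gamma(G)\}$. *)

(* Defs.v *)
From mathcomp Require Import all_boot.

Set Implicit Arguments.
Unset Strict Implicit.
Unset Printing Implicit Defensive.

(* A graph on the vertex set T is given by its edge set; requiring edges to be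
   2-element sets of vertices excludes loops and multiple edges. *)
Record sgraph (T : finType) := SGraph {
  edges : {set {set T}};
  edges_card2 : forall e, e \in edges -> #|e| = 2
}.

Section Graphs.
Variables (T : finType) (G : sgraph T).

Definition adj : rel T := fun x y => [set x; y] \in edges G.

Definition degree (x : T) : nat := #|[set y | adj x y]|.

Definition regular (k : nat) : Prop := forall x : T, degree x = k.

Definition dominating (D : {set T}) : bool :=
  [forall x, (x \notin D) ==> [exists y in D, adj x y]].

(* The full vertex set is dominating, so the minimum always exists. *)
Definition domination_number : nat :=
  #|[arg min_(D < [set: T] | dominating D) #|D|]|.

Lemma del_edges_card2 (B : {set {set T}}) e :
  e \in edges G :\: B -> #|e| = 2.
Proof. by rewrite inE => /andP[_ /edges_card2]. Qed.

Definition del_edges (B : {set {set T}}) : sgraph T :=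
  SGraph (@del_edges_card2 B).

End Graphs.

Section Bondage.
Variables (T : finType) (G : sgraph T).

Definition bonding (B : {set {set T}}) : bool :=
  (B \subset edges G) &&
  (domination_number G < domination_number (del_edges G B)).

(* If G has at least one edge, then edges G is itself bonding, so this is a
   genuine minimum; on edgeless graphs the value 0 is a convention. *)
Definition bondage_number : nat :=
  #|[arg min_(B < edges G | bonding B) #|B|]|.

End Bondage.

(* Main.v *)
(* Let F be the complement of G - B, which has n + |B| edges. If gamma(G - B) > 2 then
   any two vertices of F have a common neighbour, and it suffices to show that F has at
   least 2n - 3 edges (if some vertex is universal in F, then B contains all n - 3 edges
   of G at that vertex). This is clear when all degrees in F are at least 4. A vertex v
   always satisfies sum_(u in N(v)) deg u >= deg v + n - 1, since each other vertex has
   a neighbour in N(v); when deg v = 3 and all degrees are at least 3, summing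
   the degrees gives 2|E(F)| >= 4n - 7. When v has degree 2, its neighbours a and b form
   a dominating edge, and dominating_edge_edges applies. With B empty this gives
   gamma(G) = 2, and deleting the star of a vertex shows that n - 3 is attained. *)
Require Import Defs.
From mathcomp Require Import all_boot zify.

Set Implicit Arguments.
Unset Strict Implicit.
Unset Printing Implicit Defensive.

(** * Adjacency, incidence and degree counts *)

Section Graphs.
Variables (T : finType) (G : sgraph T).

Lemma adjC : symmetric (adj G).
Proof. by move=> x y; rewrite /adj setUC. Qed.

Lemma adj_irr x : adj G x x = false.
Proof. by apply/negP => /edges_card2; rewrite setUid cards1. Qed.

Lemma adj_neq x y : adj G x y -> x != y.
Proof. by apply: contraTneq => ->; rewrite adj_irr. Qed.

Lemma edge_adj e x : e \in edges G -> x \in e -> exists2 y, adj G x y & e = [set x; y].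
Proof.
move=> eE xe; have /cards2P[u [v [_ def_e]]] := introT eqP (edges_card2 eE).
move: xe eE; rewrite def_e !inE => /orP[] /eqP<- eE; first by exists v.
by exists u; rewrite /adj setUC.
Qed.

Lemma degreeE x : degree G x = #|[set e in edges G | x \in e]|.
Proof.
rewrite /degree -(card_in_imset (f := fun y => [set x; y])).
  apply: eq_card => e; rewrite !inE; apply/imsetP/andP => [[y]|[eE xe]].
    by rewrite inE => xy ->; rewrite set21.
  by have [y xy def_e] := edge_adj eE xe; exists y; rewrite ?inE.
move=> y z; rewrite !inE => /adj_neq xy _ /setP/(_ y).
by rewrite !inE eqxx orbT eq_sym (negPf xy) => /esym/eqP.
Qed.

Lemma handshake : \sum_x degree G x = 2 * #|edges G|.
Proof.
under eq_bigr => x _ do rewrite degreeE -sum1dep_card big_mkcondr.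
rewrite exchange_big /= mulnC -sum_nat_const; apply: eq_bigr => e eE.
by rewrite -big_mkcond /= sum1_card (edges_card2 eE).
Qed.

(** * Bounds on the domination number *)

Lemma domination_number_leP k :
  reflect (exists2 D, dominating G D & #|D| <= k) (domination_number G <= k).
Proof.
rewrite /domination_number; case: arg_minnP => [|D domD minD].
  by apply/forallP => x; rewrite inE.
apply: (iffP idP) => [?|[D' /minD]]; first by exists D.
exact: leq_trans.
Qed.

Lemma domination_number_mono (H : sgraph T) :
  subrel (adj H) (adj G) -> domination_number G <= domination_number H.
Proof.
move=> sHG; apply/domination_number_leP.
rewrite /(domination_number H); case: arg_minnP => [|D /forallP domD _].
  by apply/forallP => x; rewrite inE.
exists D => //; apply/forallP => x; apply/implyP => xD.
have /existsP[y /andP[yD xy]] := implyP (domD x) xD.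
by apply/existsP; exists y; rewrite yD sHG.
Qed.

(** * Complement graphs *)

Definition compl : sgraph T.
Proof.
by exists [set e : {set T} | (#|e| == 2) && (e \notin edges G)] => e; rewrite inE => /andP[/eqP].
Defined.

Lemma adj_compl x y : adj compl x y = (x != y) && ~~ adj G x y.
Proof. by rewrite /adj inE cards2; case: (x != y). Qed.

Lemma card_edges_compl : 2 * (#|edges compl| + #|edges G|) = #|T| * #|T|.-1.
Proof.
have -> : #|edges compl| + #|edges G| = 'C(#|T|, 2).
  rewrite -cardsT -cards_draws -[RHS](cardsID (edges G)) addnC.
  congr (_ + _); apply: eq_card => e; rewrite !inE.
    by rewrite subsetT /=; case: (boolP (e \in edges G)) => [/edges_card2->|];
       rewrite ?andbF.
  by rewrite subsetT andbC.
(* One of two consecutive integers is even, so the halving in [bin2] is exact. *)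
by rewrite bin2 -[RHS]odd_double_half -mul2n; case: #|T| => //= m; rewrite oddM /= andNb.
Qed.

(** * Edge counts when any two vertices have a common neighbour *)

Definition common_nbrs := forall x y, x != y -> exists2 z, adj G x z & adj G y z.

(** Inclusion-exclusion: the [+ 1] is the edge ab, the only one counted in both degrees. *)
Lemma card_edges_avoiding a b :
    adj G a b -> #|[set e in edges G | (a \notin e) && (b \notin e)]| +
    (degree G a + degree G b) <= #|edges G| + 1.
Proof.
move=> ab; rewrite !degreeE.
set Ea := [set e in edges G | a \in e]; set Eb := [set e in edges G | b \in e].
have sEG : Ea :|: Eb \subset edges G.
  by apply/subsetP => e; rewrite !inE => /orP[] /andP[].
rewrite -cardsUI -(cardsID (Ea :|: Eb) (edges G)) (setIidPr sEG).
rewrite addnCA -addnA leq_add2l leq_add //.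
  apply/subset_leq_card/subsetP => e; rewrite !inE.
  by case/and3P => -> /negPf-> /negPf->.
rewrite -(cards1 [set a; b]); apply/subset_leq_card/subsetP => e; rewrite !inE.
case/andP => /andP[eE ae] /andP[_ be]; rewrite eq_sym eqEcard subUset !sub1set ae be.
by rewrite (edges_card2 eE) cards2 (adj_neq ab).
Qed.

(* A functional graph without 2-cycles has as many edges as arcs. *)
Lemma card_edges_functional (S : {set T}) (E : {set {set T}}) (p : T -> T) :
    (forall w, w \in S -> [set w; p w] \in E) ->
    (forall w, w \in S -> p (p w) != w) -> #|S| <= #|E|.
Proof.
move=> pE p2; rewrite -(card_in_imset (f := fun w => [set w; p w]) (D := S)).
  by apply/subset_leq_card/subsetP => _ /imsetP[w wS ->]; apply: pE.
(* Distinct v and w with the same edge would be swapped by [p], forming a 2-cycle. *)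
move=> v w vS wS /setP eqvw; apply/eqP; apply: contraT => neq_vw.
have /eqP def_w: w == p v.
  by have := eqvw w; rewrite !inE eqxx eq_sym (negPf neq_vw).
have /eqP def_v: v == p w.
  by have := eqvw v; rewrite !inE eqxx (negPf neq_vw) => /esym.
by have := p2 w wS; rewrite -def_v -def_w eqxx.
Qed.

(* At least deg a + deg b - 1 = #|T| + #|N a :&: N b| - 1 edges meet {a, b}. The other
   #|T| - 2 - #|N a :&: N b| vertices outside {a, b} form [S]; a functional graph on
   [S] without 2-cycles provides as many edges avoiding a and b. *)
Lemma dominating_edge_edges a b :
    common_nbrs -> adj G a b -> (forall w, adj G a w || adj G b w) ->
    degree G a < #|T|.-1 -> degree G b < #|T|.-1 -> 2 * #|T| <= #|edges G| + 3.
Proof.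
move=> nbr ab dom_ab dega degb.
pose N x := [set y | adj G x y].
pose S := ~: ([set a; b] :|: N a :&: N b).
pose E := [set e in edges G | (a \notin e) && (b \notin e)].
have not_univ c : degree G c < #|T|.-1 -> exists2 w, w != c & ~~ adj G c w.
  move=> degc; have: ~~ ([set~ c] \subset N c).
    by apply: contraTN degc => /subset_leq_card; rewrite cardsC1 -leqNgt.
  by case/subsetPn => w; rewrite !inE; exists w.
suff leSE : #|S| <= #|E|.
  have := card_edges_avoiding ab; rewrite -/E.
  have: degree G a + degree G b = #|T| + #|N a :&: N b|.
    rewrite -cardsUI; congr (_ + _); rewrite -cardsT; apply: eq_card => w.
    by rewrite !inE dom_ab.
  have: #|[set a; b] :|: N a :&: N b| <= 2 + #|N a :&: N b|.
    by rewrite (leq_trans (leq_card_setU _ _)) // leq_add2r cards2; case: (a == b).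
  have := cardsC ([set a; b] :|: N a :&: N b); rewrite -/S; lia.
(* [S] consists of the neighbours of a alone ([inA]) and of b alone ([inB]). Both kinds occur, since
   neither a nor b is universal. *)
pose inA w := [&& w != b, adj G a w & ~~ adj G b w].
pose inB w := [&& w != a, adj G b w & ~~ adj G a w].
have inS w : (w \in S) = inA w || inB w.
  rewrite !inE /inA /inB; have := dom_ab w.
  have [->|wa] := eqVneq w a; first by rewrite adj_irr !(adjC b) ab andbF.
  have [->|wb] := eqVneq w b; first by rewrite adj_irr ab andbF.
  by case: (adj G a w); case: (adj G b w).
have [x0 Ax0] : exists x, inA x.
  have [w wb bw] := not_univ _ degb; exists w; rewrite /inA wb bw.
  by have := dom_ab w; rewrite (negPf bw) orbF => ->.
have [y0 By0] : exists y, inB y.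
  have [w wb bw] := not_univ _ dega; exists w; rewrite /inB wb bw.
  by have := dom_ab w; rewrite (negPf bw) /= => ->.
have nbrAB x y : inA x -> inB y ->
    exists z, [&& adj G x z, adj G y z, z != a & z != b].
  move=> /and3P[xb ax bx] /and3P[ya by_ ay].
  have [|z xz yz] := nbr x y; first by apply: contraNneq bx => ->.
  exists z; rewrite xz yz /=; apply/andP; split.
    by apply: contraNneq ay => <-; rewrite adjC.
  by apply: contraNneq bx => <-; rewrite adjC.
have S_ab w : w \in S -> (w != a) && (w != b).
  by rewrite !inE !negb_or => /andP[].
have edgeE w z : w \in S -> adj G w z -> z != a -> z != b -> [set w; z] \in E.
  move=> /S_ab/andP[wa wb] wz za zb; rewrite !inE -/(adj G w z) wz !negb_or.
  by rewrite !(eq_sym a) !(eq_sym b) wa wb za zb.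
have [/existsP[x /existsP[y /and3P[Ax By xy]]]|noAB] :=
    boolP [exists x, exists y, [&& inA x, inB y & adj G x y]].
  (* a triangle [x, y, z] is oriented cyclically; all other vertices of [S] are
     within distance 2 of [x, y] and point towards it *)
  have [z /and4P[xz yz za zb]] := nbrAB x y Ax By.
  (* The premise [w \in S] stands under the existential so that [fin_all_exists] gives a total
     function; outside [S] the witness is arbitrary. *)
  have nbr2 w : exists q, w \in S ->
      [&& adj G w q, adj G x q || adj G y q, q != a & q != b].
    have [Aw|nAw] := boolP (inA w).
      by have [q /and4P[wq yq qa qb]] := nbrAB _ _ Aw By; exists q; rewrite wq yq qa qb orbT.
    have [Bw|nBw] := boolP (inB w).
      by have [q /and4P[wq yq qa qb]] := nbrAB _ _ Ax Bw; exists q; rewrite wq yq qa qb.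
    by exists w; rewrite inS (negPf nAw) (negPf nBw).
  have [q qP] := fin_all_exists nbr2.
  pose p w := if w == x then y else if w == y then z else if w == z then x else
    if adj G w x then x else if adj G w y then y else q w.
  have /andP[xa xb] : (x != a) && (x != b) by rewrite S_ab ?inS ?Ax.
  have /andP[ya yb] : (y != a) && (y != b) by rewrite S_ab ?inS ?By ?orbT.
  have [nxy nxz nyz] := And3 (adj_neq xy) (adj_neq xz) (adj_neq yz).
  apply: (@card_edges_functional S E p) => w wS.
    rewrite /p; have [->|wx] := eqVneq w x; first by apply: edgeE; rewrite ?inS ?Ax.
    have [->|wy] := eqVneq w y; first by apply: edgeE; rewrite ?inS ?By ?orbT.
    have [def_w|wz] := eqVneq w z; first by apply: edgeE; rewrite // def_w adjC.
    case: ifP => [wx'|_]; first exact: edgeE.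
    case: ifP => [wy'|_]; first exact: edgeE.
    by have /and4P[? _ ? ?] := qP w wS; apply: edgeE.
  have px : p x = y by rewrite /p eqxx.
  have py : p y = z by rewrite /p (eq_sym y) (negPf nxy) eqxx.
  have pz : p z = x by rewrite /p !(eq_sym z) (negPf nxz) (negPf nyz) eqxx.
  have [->|wx] := eqVneq w x; first by rewrite px py eq_sym.
  have [->|wy] := eqVneq w y; first by rewrite py pz.
  have [->|wz] := eqVneq w z; first by rewrite pz px.
  rewrite {2}/p (negPf wx) (negPf wy) (negPf wz).
  case: ifP => [_|nwx]; first by rewrite px eq_sym.
  case: ifP => [_|nwy]; first by rewrite py eq_sym.
  (* [q w] differs from x and y and is adjacent to one of them, so [p] sends it to x or y, never
     back to w. *)
  have /and4P[wq xyq _ _] := qP w wS.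
  have qx : q w != x by apply: contraFneq nwx => <-.
  have qy : q w != y by apply: contraFneq nwy => <-.
  rewrite /p (negPf qx) (negPf qy) !(adjC (q w)).
  case: ifP => _; first by rewrite eq_sym.
  by case: ifP xyq => [_ _|_ /= ->]; rewrite eq_sym.
have nadjAB x y : inA x -> inB y -> adj G x y = false.
  move=> Ax By; apply: contraNF noAB => xy; apply/existsP; exists x.
  by apply/existsP; exists y; rewrite Ax By.
(* Without edges between the two kinds, a common neighbour of vertices of different kinds lies
   outside [S]. All arcs thus leave [S], and the default value a is not in [S]. *)
have nbrC w : exists q, w \in S -> [&& adj G w q, q \notin S, q != a & q != b].
  have [Aw|nAw] := boolP (inA w).
    have [q /and4P[wq yq qa qb]] := nbrAB _ _ Aw By0; exists q => _.
    rewrite wq qa qb inS !andbT negb_or /=; apply/andP; split.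
      by apply: contraL yq => /nadjAB/(_ By0); rewrite adjC => ->.
    by apply: contraL wq => /(nadjAB _ _ Aw) ->.
  have [Bw|nBw] := boolP (inB w).
    have [q /and4P[xq wq qa qb]] := nbrAB _ _ Ax0 Bw; exists q => _.
    rewrite wq qa qb inS !andbT negb_or /=; apply/andP; split.
      by apply: contraL wq => /nadjAB/(_ Bw); rewrite adjC => ->.
    by apply: contraL xq => /(nadjAB _ _ Ax0) ->.
  by exists w; rewrite inS (negPf nAw) (negPf nBw).
have [q qP] := fin_all_exists nbrC.
apply: (@card_edges_functional S E (fun w => if w \in S then q w else a)) => w wS;
  rewrite wS; have /and4P[wq qS qa qb] := qP w wS; first exact: edgeE.
by rewrite (negPf qS) eq_sym; case/andP: (S_ab _ wS).
Qed.

(** Double counting of adjacent pairs (u, w) with u in N(v): w = v occurs deg v times, every other w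
    at least once. *)
Lemma sum_degree_nbrs v :
    common_nbrs -> degree G v + #|T|.-1 <= \sum_(u in [set y | adj G v y]) degree G u.
Proof.
move=> nbr; under eq_bigr => u _ do rewrite /degree -sum1dep_card big_mkcond.
rewrite exchange_big (bigD1 v) //= leq_add //.
  rewrite -[degree G v]sum1_card; apply: leq_sum => u; rewrite inE.
  by rewrite adjC => ->.
rewrite -(cardC1 v) -sum1_card; apply: leq_sum => w; rewrite inE => wv.
have [z wz vz] := nbr w v wv.
by rewrite (bigD1 z) ?inE //= adjC wz.
Qed.

Lemma common_nbrs_edges :
    1 < #|T| -> common_nbrs -> (forall c, degree G c < #|T|.-1) ->
  2 * #|T| <= #|edges G| + 3.
Proof.
move=> T_gt1 nbr not_univ.
have deg_ge2 v : 1 < degree G v.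
  (* No vertex is isolated and every edge lies in a triangle. *)
  have /card_gt0P[w] : 0 < #|predC1 v| by rewrite cardC1; lia.
  rewrite inE eq_sym => /nbr[x vx _]; have [y vy xy] := nbr _ _ (adj_neq vx).
  have <-: #|[set x; y]| = 2 by rewrite cards2 (adj_neq xy).
  apply/subset_leq_card/subsetP => z.
  by rewrite !inE => /orP[] /eqP->.
have [v vle|deg_ge4] := pickP (fun v => degree G v <= 3); last first.
  have: #|T| * 4 <= \sum_v degree G v.
    by rewrite -sum_nat_const; apply: leq_sum => v _; rewrite ltnNge deg_ge4.
  by rewrite handshake; lia.
have [w wle|deg_ge3] := pickP (fun v => degree G v <= 2).
  have: degree G w == 2 by rewrite eqn_leq wle deg_ge2.
  case/cards2P => a [b [_ def_N]].
  have N u : adj G w u = (u == a) || (u == b).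
    by have/setP/(_ u) := def_N; rewrite !inE.
  (* The common neighbour of u and w can only be a or b. *)
  have dom u : u != w -> adj G a u || adj G b u.
    by move=> /nbr[z uz]; rewrite N => /orP[] /eqP<-; rewrite !(adjC _ u) uz ?orbT.
  have wa : adj G w a by rewrite N eqxx.
  have ab : adj G a b.
    have [z] := nbr _ _ (adj_neq wa); rewrite N => /orP[] /eqP-> //.
    by rewrite adj_irr.
  apply: (dominating_edge_edges nbr ab) => // u.
  by have [->|/dom//] := eqVneq u w; rewrite adjC wa.
have {vle} degv : degree G v = 3 by apply/eqP; rewrite eqn_leq vle ltnNge deg_ge3.
(* The closed neighbourhood of v has degree sum at least 3 + (3 + n - 1), the other n - 4 vertices
   at least 3(n - 4). By parity, 2|E| >= 4n - 7 improves to 4n - 6. *)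
have := sum_degree_nbrs v nbr; have := handshake.
have vN : v \notin [set y | adj G v y] by rewrite inE adj_irr.
set S := v |: [set y | adj G v y]; have cardS : #|S| = 4 by rewrite cardsU1 vN -degv.
rewrite (bigID (mem S)) big_setU1 //= degv.
have: #|[predC S]| * 3 <= \sum_(i | i \notin S) degree G i.
  by rewrite -sum_nat_const; apply: leq_sum => u _; rewrite ltnNge deg_ge3.
have: 4 + #|[predC S]| = #|T| by rewrite -cardS cardC.
move: #|[predC S]| (\sum_(i | i \notin S) _) (\sum_(i in _) _) => m s2 s1; set n := #|T|; lia.
Qed.

End Graphs.

(** * Bondage in regular graphs of degree n - 3 *)

Section Bondage.
Variables (T : finType) (G : sgraph T).
Hypotheses (T_ge4 : 3 < #|T|) (regG : regular G (#|T| - 3)).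

Lemma card_regular_edges : 2 * #|edges G| = #|T| * (#|T| - 3).
Proof.
rewrite -handshake -sum_nat_const; apply: eq_bigr => x _; exact: regG.
Qed.

Lemma del_edges_adj B x y : adj (del_edges G B) x y -> adj G x y.
Proof. by rewrite /adj !inE => /andP[]. Qed.

Lemma card_domination_gt2 (B : {set {set T}}) :
  B \subset edges G -> 2 < domination_number (del_edges G B) -> #|T| - 3 <= #|B|.
Proof.
rewrite ltnNge => sBG /negP gt2; pose F := compl (del_edges G B).
have nbr : common_nbrs F.
  (* A vertex that x and y fail to dominate in G - B is their common neighbour in [F]. *)
  move=> x y xy; have: ~~ dominating (del_edges G B) [set x; y].
    apply/negP => dom; case: gt2; apply/domination_number_leP.
    by exists [set x; y]; rewrite ?cards2 ?xy.
  rewrite negb_forall => /existsP[z]; rewrite negb_imply !inE negb_or.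
  case/andP => /andP[zx zy] /existsPn dom; exists z; rewrite adj_compl eq_sym.
    by rewrite zx adjC; have := dom x; rewrite !inE eqxx.
  by rewrite zy adjC; have := dom y; rewrite !inE eqxx orbT.
have [c univ|not_univ] := pickP (fun c => #|T|.-1 <= degree F c).
  have Fc : [set y | adj F c y] = [set~ c].
    apply/eqP; rewrite eqEcard cardsC1 [_ <= _]univ andbT; apply/subsetP => y.
    by rewrite !inE eq_sym => /adj_neq.
  rewrite -(regG c) degreeE; apply/subset_leq_card/subsetP => e.
  rewrite inE => /andP[eE ce]; apply: contraT => eB.
  have eE' : e \in edges (del_edges G B) by rewrite inE eB.
  have [y cy _] := edge_adj eE' ce; have /setP/(_ y) := Fc.
  by rewrite !inE adj_compl cy andbF eq_sym (adj_neq cy).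
have degF c : degree F c < #|T|.-1 by rewrite ltnNge not_univ.
have := common_nbrs_edges (ltnW (ltnW T_ge4)) nbr degF.
have := card_edges_compl (del_edges G B); have := cardsID B (edges G).
have := card_regular_edges; rewrite (setIidPr sBG) -/F /=.
case: #|T| T_ge4 => [|[|[|n]]] // _; rewrite !subSS subn0; nia.
Qed.

Definition star x : {set {set T}} := [set e in edges G | x \in e].

(** The isolated x belongs to every dominating set, so a second vertex y would have to be adjacent
    to all n - 2 others, exceeding its degree n - 3. *)
Lemma domination_del_star x : 2 < domination_number (del_edges G (star x)).
Proof.
rewrite ltnNge; apply/negP => /domination_number_leP[D /forallP dom leD].
have isolated y : adj (del_edges G (star x)) x y = false.
  by rewrite /adj !inE eqxx /= andbT andNb.
have xD : x \in D.
  apply: contraT => xD; have /existsP[y] := implyP (dom x) xD.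
  by rewrite isolated andbF.
have [y sDxy] : exists y, D \subset [set x; y].
  have [D0|[y yD]] := set_0Vmem (D :\ x).
    (* When D = {x}, taking y = x is harmless: y then needs even n - 1 neighbours. *)
    by exists x; rewrite setUid -(setD1K xD) D0 setU0.
  exists y; rewrite -(setD1K xD) setUS //.
  have /eqP-> // : [set y] == D :\ x.
  by rewrite eqEcard sub1set yD cards1; have := cardsD1 x D; rewrite xD; lia.
have: [set~ x] :\ y \subset [set z | adj G y z].
  apply/subsetP => z; rewrite !inE => /andP[zy zx].
  have zD : z \notin D.
    by apply: contra (subsetP sDxy z) _; rewrite !inE negb_or zx.
  have /existsP[w /andP[/(subsetP sDxy)]] := implyP (dom z) zD.
  rewrite !inE => /orP[] /eqP->; rewrite adjC ?isolated //.
  exact: del_edges_adj.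
move/subset_leq_card; rewrite -/(degree G y) regG.
have := cardsD1 y [set~ x]; rewrite cardsC1.
by case: (y \in _); lia.
Qed.

Lemma domination_number_regular : domination_number G = 2.
Proof.
apply/eqP; rewrite eqn_leq; apply/andP; split.
  rewrite leqNgt; apply/negP => gt2.
  (* Monotonicity carries the bound from [G] to [del_edges G set0]; the conclusion n - 3 <= 0 is
     absurd. *)
  have := card_domination_gt2 (sub0set _) (leq_trans gt2 (domination_number_mono _)).
  by rewrite cards0 => /(_ (@del_edges_adj set0)); lia.
rewrite ltnNge; apply/negP => /domination_number_leP[D /forallP dom leD].
have [y sDy] : exists y, D \subset [set y].
  have [->|[y yD]] := set_0Vmem D.
    have /card_gt0P[y _] : 0 < #|T| by exact: ltnW (ltnW (ltnW T_ge4)).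
    by exists y; rewrite sub0set.
  exists y; have /eqP-> // : [set y] == D.
  by rewrite eqEcard sub1set yD cards1.
have: [set~ y] \subset [set z | adj G y z].
  apply/subsetP => z; rewrite !inE => zy.
  have zD : z \notin D by apply: contra (subsetP sDy z) _; rewrite inE.
  have /existsP[w /andP[/(subsetP sDy)]] := implyP (dom z) zD.
  by rewrite inE => /eqP->; rewrite adjC.
by move/subset_leq_card; rewrite cardsC1 -/(degree G y) regG; lia.
Qed.

End Bondage.

Theorem theorem2p1 (n : nat) (T : finType) (G : sgraph T) :
  4 <= n -> #|T| = n -> regular G (n - 3) -> bondage_number G = n - 3.
Proof.
move=> n_ge4 cardT; rewrite -cardT => regG; rewrite -cardT in n_ge4.
have dom2 := domination_number_regular n_ge4 regG.
have /card_gt0P[x _] : 0 < #|T| by exact: ltnW (ltnW (ltnW n_ge4)).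
have bond_star : bonding G (star G x).
  rewrite /bonding dom2 domination_del_star // andbT.
  by apply/subsetP => e; rewrite inE => /andP[].
rewrite /bondage_number; case: arg_minnP => [|B /andP[sBG]].
  (* The default [edges G] of the minimum must be bonding: the edgeless graph is a subgraph of G
     minus the star. *)
  have /andP[_ lt] := bond_star; rewrite /bonding subxx (leq_trans lt) //.
  by apply: domination_number_mono => y z; rewrite /adj /= setDv inE.
rewrite dom2 => gt2 /(_ _ bond_star); rewrite -[#|star G x|]degreeE regG => leB.
by apply/eqP; rewrite eqn_leq leB (card_domination_gt2 n_ge4 regG sBG gt2).
Qed.
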